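(* Let $n\ge 2$ and let $\Omega_1,\Omega_2\subset\mathbb{R}^n$ be regions with generic Blum medial axes $M_1,M_2$. For $i=1,2$ let $\Gamma_i\subset M_i$ be the $A_1^3$ stratum, along which three smooth medial sheets $S^{(i)}_1,S^{(i)}_2,S^{(i)}_3$ of $M_i$ meet; let $U_1,U_2,U_3$ denote the three radial vectors at points of $\Gamma_1$ and $U_1',U_2',U_3'$ the three radial vectors at points of $\Gamma_2$. For $j=1,2,3$ let $\chi^{(i)}_j$ be the cross ratio map on $\Gamma_i$ sending $y\in\Gamma_i$ to the set of cross ratio values of the four hyperplanes consisting of the three limiting tangent hyperplanes $T_yS^{(i)}_1,T_yS^{(i)}_2,T_yS^{(i)}_3$ and the hyperplane spanned by $T_y\Gamma_i$ and the $j$-th radial vector at $y$ (that is, $U_j(y)$ if $i=1$ and $U_j'(y)$ if $i=2$). Suppose $\varphi$ is a diffeomorphism from a neighborhood of a branch point $x\in\Gamma_1$ to a neighborhood of $\varphi(x)\in\Gamma_2$ which sends $\Gamma_1$ to $\Gamma_2$, sends the medial sheets $S^{(1)}_j$ to the medial sheets $S^{(2)}_j$ ($j=1,2,3$), within these neighborhoods, and whose derivative preserves radial lines, i.e. $$d\varphi(y)\big(\langle U_j(y)\rangle\big)=\langle U_j'(\varphi(y))\rangle,\qquad j=1,2,3,$$ for points $y$ of $\Gamma_1$ in the given neighborhood of $x$. Then $$\chi^{(2)}_j\circ\varphi=\chi^{(1)}_j\qquad\text{for } j=1,2,3$$ on the part of $\Gamma_1$ in this neighborhood.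
   Context: The Blum medial axis $M$ of a region $\Omega\subset\mathbb{R}^n$ (with piecewise smooth boundary $\mathcal{B}$) is the closure of the set of points of $\Omega$ having at least two closest points on $\mathcal{B}$. The radial vectors at $x\in M$ are the vectors from $x$ to its closest points on $\mathcal{B}$ (so the radial vector field is multivalued on $M$); $\langle U\rangle$ denotes the line spanned by $U$ (a radial line). $A_1^3$ stratum of a generic Blum medial axis: a smooth submanifold $\Gamma\subset M$ of codimension $2$ in $\mathbb{R}^n$ (branch points if $n=2$, $Y$-branch curves if $n=3$), whose points have exactly three closest points on $\mathcal{B}$, hence exactly three radial vectors, and near which $M$ consists of $\Gamma$ and three smooth codimension one sheets meeting along $\Gamma$. At each $y\in\Gamma$ each sheet $S_j$ has a unique limiting tangent hyperplane $T_yS_j$ (the limit of the tangent hyperplanes $T_{y_k}S_j$ for $y_k\in S_j$, $y_k\to y$), it contains $T_y\Gamma$, and the three limiting tangent hyperplanes are distinct. Each radial vector at $y$ lies outside $T_y\Gamma$, so together with $T_y\Gamma$ it spans a hyperplane. Cross ratio of points of a projective line: $$R(z_1,\dots,z_4)=\frac{(z_1-z_4)(z_3-z_2)}{(z_1-z_2)(z_3-z_4)}\in\mathbb{RP}^1,$$ extended by limits if some $z_i=\infty$; it is well defined in $\mathbb{RP}^1$ as soon as at least three of the four points are distinct. Lines through the origin in a $2$-dimensional real vector space are points of a real projective line, so four ordered lines (at least three distinct) have a cross ratio; in $\mathbb{R}^2$, for lines $y=a_ix$ it is $R(a_1,\dots,a_4)$. If four linear hyperplanes $H_1,\dots,H_4\subset\mathbb{R}^n$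 contain a common codimension $2$ subspace $L$, their cross ratio is that of the lines $H_i\cap\Pi$ in any plane $\Pi$ through the origin transverse to $L$ (independent of $\Pi$). Set of cross ratio values: permuting the four objects replaces the cross ratio $\lambda$ by one of $\lambda,\frac1\lambda,1-\lambda,\frac1{1-\lambda},\frac{\lambda-1}{\lambda},\frac{\lambda}{\lambda-1}$; this set is the orbit of $\lambda$ under the group isomorphic to $\mathcal{S}_3$ generated by $\lambda\mapsto1/\lambda$, $\lambda\mapsto1-\lambda$ on $\mathbb{RP}^1$. The cross ratio maps take values in the set $\mathbb{RP}^1/\mathcal{S}_3$ of orbits. *)

(* Defs.v *)
From HB Require Import structures.
From mathcomp Require Import all_boot all_order all_algebra.
From mathcomp Require Import all_classical all_reals all_analysis.
Set Implicit Arguments.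
Unset Strict Implicit.
Unset Printing Implicit Defensive.
Import Order.TTheory GRing.Theory Num.Theory.
Import numFieldNormedType.Exports.
Local Open Scope classical_set_scope.
Local Open Scope ring_scope.

Section smooth_maps.
Context {R : realType} {V W : normedModType R}.

(* In finite dimension, f is C^k on the open set A iff its iterated directional
   derivatives up to order k exist and are continuous on A. *)
Fixpoint Ck_on (k : nat) (A : set V) (f : V -> W) : Prop :=
  match k with
  | 0%N => forall x, A x -> {for x, continuous f}
  | k'.+1 => (forall x, A x -> differentiable f x) /\
             (forall v, Ck_on k' A (fun x => 'D_v f x))
  end.

Definition smooth_on (A : set V) (f : V -> W) : Prop := forall k, Ck_on k A f.

End smooth_maps.

Definition diffeomorphism {R : realType} {n : nat} (W W' : set 'rV[R]_n)
    (phi : 'rV[R]_n -> 'rV[R]_n) : Prop :=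
  [/\ open W, open W', smooth_on W phi, phi @` W = W' &
    exists psi : 'rV[R]_n -> 'rV[R]_n,
      smooth_on W' psi /\ forall x, W x -> psi (phi x) = x].

Section submanifolds.
Context {R : realType} {n : nat}.
Local Notation E := 'rV[R]_n.

Definition submanifold (d : nat) (M : set E) : Prop :=
  forall p, M p -> exists (W W' : set E) (psi : E -> E),
    [/\ W p, diffeomorphism W W' psi &
      psi @` (M `&` W) =
        W' `&` [set z | forall i : 'I_n, (d <= i)%N -> z ord0 i = 0]].

Definition tangent_vector (M : set E) (y v : E) : Prop :=
  exists (I : set R) (c : R -> E),
    [/\ open I /\ I 0, @smooth_on R R^o E I c, c @` I `<=` M, c 0 = y &
      derive1 c 0 = v].

(* When M is a submanifold, the velocities at y form a linear subspace, which is
   then the value; the default 0 only concerns other sets M. *)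
Definition tangent_space (M : set E) (y : E) : {vspace E} :=
  xget 0%VS [set T : {vspace E} | forall v, v \in T <-> tangent_vector M y v].

(* Convergence in the Grassmannian of d-planes, i.e. in the quotient topology
   of the space of d-frames. *)
Definition subspace_cvg (d : nat) (T : nat -> {vspace E}) (H : {vspace E}) :
    Prop :=
  exists (e : 'I_d -> nat -> E) (f : 'I_d -> E),
    [/\ \forall k \near \oo, basis_of (T k) [seq e i k | i <- enum 'I_d],
        forall i, e i @ \oo --> f i &
        basis_of H [seq f i | i <- enum 'I_d]].

Definition is_limiting_tangent (S : set E) (y : E) (H : {vspace E}) : Prop :=
  forall u : nat -> E, (forall k, S (u k)) -> u @ \oo --> y ->
    subspace_cvg n.-1 (fun k => tangent_space S (u k)) H.

Definition limiting_tangent (S : set E) (y : E) : {vspace E} :=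
  xget 0%VS [set H | is_limiting_tangent S y H].

End submanifolds.

Section blum_medial_axis.
Context {R : realType} {n : nat}.
Local Notation E := 'rV[R]_n.

(* The library norm on row vectors is the sup norm, hence this definition. *)
Definition edist (x y : E) : R := Num.sqrt (\sum_i (x ord0 i - y ord0 i) ^+ 2).

Definition bdry (Omega : set E) : set E := closure Omega `\` Omega°.

(* A smooth hypersurface at a dense set of points, and locally covered by
   finitely many smooth hypersurfaces (the pieces). *)
Definition piecewise_smooth (B : set E) : Prop :=
  B `<=` closure [set b | B b /\
      exists W : set E, [/\ open W, W b & submanifold n.-1 (B `&` W)]] /\
  forall b, B b -> exists (W : set E) (k : nat) (H : 'I_k -> set E),
    [/\ open W, W b, forall i, submanifold n.-1 (H i) &
      B `&` W `<=` \bigcup_i H i].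

Definition region (Omega : set E) : Prop :=
  [/\ Omega !=set0, Omega `<=` closure Omega° & piecewise_smooth (bdry Omega)].

Definition closest_points (Omega : set E) (y : E) : set E :=
  [set b | bdry Omega b /\ forall b', bdry Omega b' -> edist y b <= edist y b'].

Definition medial_axis (Omega : set E) : set E :=
  closure [set y | Omega y /\ exists b1 b2, [/\ closest_points Omega y b1,
                                closest_points Omega y b2 & b1 <> b2]].

Definition radial_vectors (Omega : set E) (y : E) : set E :=
  [set b - y | b in closest_points Omega y].

(* M consists, near the point y of G, of G and of three smooth sheets S j which
   meet along G and have distinct limiting tangent hyperplanes at y. *)
Definition medial_sheets_at (Omega G : set E) (S : 'I_3 -> set E) (y : E) :
    Prop :=
  (exists V : set E,
     [/\ open V /\ V y,
         medial_axis Omega `&` V = (G `|` \bigcup_j S j) `&` V,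
         forall j, submanifold n.-1 (S j `&` V),
         forall j, S j `&` G `&` V = set0 &
         forall i j, i != j -> S i `&` S j `&` V = set0]) /\
  [/\ forall j, closure (S j) y,
      forall j, exists! H, is_limiting_tangent (S j) y H,
      forall j, (tangent_space G y <= limiting_tangent (S j) y)%VS &
      forall i j, i != j ->
        limiting_tangent (S i) y <> limiting_tangent (S j) y].

Definition A13_stratum (Omega G : set E) : Prop :=
  [/\ G `<=` medial_axis Omega,
      submanifold (n - 2) G,
      forall y, G y -> (closest_points Omega y #= `I_3)%card,
      forall y, G y -> exists S : 'I_3 -> set E,
        exists2 W : set E, open W /\ W y &
          forall z, G z -> W z -> medial_sheets_at Omega G S z &
      forall y U, G y -> radial_vectors Omega y U -> U \notin tangent_space G y].

(* U lists the radial vectors at y. *)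
Definition radial_labelling (Omega : set E) (U : 'I_3 -> E -> E) (y : E) :
    Prop :=
  injective (U ^~ y) /\ range (U ^~ y) = radial_vectors Omega y.

End blum_medial_axis.

Section cross_ratios.
Context {R : realType}.

(* The real projective line R + {oo}; None is the point oo. *)
Local Notation RP1 := (option R).

Definition det2 (u v : R * R) : R := u.1 * v.2 - u.2 * v.1.

(* Cross ratio of the points [u1], ..., [u4] given by homogeneous coordinates,
   where [(1, z)] is the point z and [(0, 1)] is oo. Each u_i occurs once in the
   numerator and once in the denominator, so that this extends
   (z1 - z4)(z3 - z2) / ((z1 - z2)(z3 - z4)) by continuity (cross_ratio_affine,
   cross_ratio_oo1). *)
Definition cross_ratio (u1 u2 u3 u4 : R * R) : RP1 :=
  let num := det2 u1 u4 * det2 u3 u2 in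
  let den := det2 u1 u2 * det2 u3 u4 in
  if den == 0 then None else Some (num / den).

Lemma cross_ratio_affine (z1 z2 z3 z4 : R) :
  z1 != z2 -> z3 != z4 ->
  cross_ratio (1, z1) (1, z2) (1, z3) (1, z4) =
  Some ((z1 - z4) * (z3 - z2) / ((z1 - z2) * (z3 - z4))).
Proof.
move=> h12 h34; rewrite /cross_ratio /det2 /= !mul1r !mulr1.
rewrite -[z4 - z1]opprB -[z2 - z3]opprB -[z2 - z1]opprB -[z4 - z3]opprB !mulrNN.
by rewrite mulf_eq0 !subr_eq0 (negbTE h12) (negbTE h34).
Qed.

Lemma cross_ratio_oo1 (z2 z3 z4 : R) :
  z3 != z4 ->
  cross_ratio (0, 1) (1, z2) (1, z3) (1, z4) = Some ((z3 - z2) / (z3 - z4)).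
Proof.
move=> h34; rewrite /cross_ratio /det2 /= !mul1r !mulr1 !mul0r sub0r !mulN1r.
by rewrite !opprB subr_eq0 (negbTE h34).
Qed.

(* l is the cross ratio of the lines H_i :&: P of the plane P, where P is some
   plane transverse to L and u_i are the coordinates of a generator of
   H_i :&: P in a basis (e, f) of P. *)
Definition is_hyperplane_cross_ratio {n : nat}
    (L H1 H2 H3 H4 : {vspace 'rV[R]_n}) (l : RP1) : Prop :=
  exists (P : {vspace 'rV[R]_n}) (e f : 'rV[R]_n),
    let line (u : R * R) := <[u.1 *: e + u.2 *: f]>%VS in
    [/\ basis_of P [:: e; f], (L :&: P)%VS = 0%VS, (L + P)%VS = fullv &
      exists u1 u2 u3 u4 : R * R,
        [/\ (H1 :&: P)%VS = line u1, (H2 :&: P)%VS = line u2,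
            (H3 :&: P)%VS = line u3, (H4 :&: P)%VS = line u4 &
            l = cross_ratio u1 u2 u3 u4]].

(* For four hyperplanes containing L, at least three of them distinct, the value
   l is unique: it depends neither on P nor on the coordinates. *)
Definition hyperplane_cross_ratio {n : nat}
    (L H1 H2 H3 H4 : {vspace 'rV[R]_n}) : RP1 :=
  xget None [set l | is_hyperplane_cross_ratio L H1 H2 H3 H4 l].

Definition RP1_inv (l : RP1) : RP1 :=
  match l with
  | None => Some 0
  | Some r => if r == 0 then None else Some r^-1
  end.

Definition RP1_1sub (l : RP1) : RP1 :=
  if l is Some r then Some (1 - r) else None.

(* In order: l, 1 / l, 1 - l, 1 / (1 - l), (l - 1) / l, l / (l - 1). *)
Definition S3_orbit (l : RP1) : set RP1 :=
  [set` [:: l; RP1_inv l; RP1_1sub l; RP1_inv (RP1_1sub l);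
            RP1_1sub (RP1_inv l); RP1_inv (RP1_1sub (RP1_inv l))]].

(* The cross ratio map chi_j for U the j-th radial vector field. *)
Definition chi {n : nat} (G : set 'rV[R]_n) (S : 'I_3 -> set 'rV[R]_n)
    (U : 'rV[R]_n -> 'rV[R]_n) (y : 'rV[R]_n) : set RP1 :=
  let T := tangent_space G y in
  let H (j : nat) := limiting_tangent (S (inord j)) y in
  S3_orbit (hyperplane_cross_ratio T (H 0%N) (H 1%N) (H 2%N) (T + <[U y]>)%VS).

End cross_ratios.

(* Main.v *)
From HB Require Import structures.
Require Import Defs.
From mathcomp Require Import all_boot all_order all_algebra.
From mathcomp Require Import all_classical all_reals all_analysis.
Import Order.TTheory GRing.Theory Num.Theory.
Import numFieldNormedType.Exports.
Local Open Scope classical_set_scope.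
Local Open Scope ring_scope.

(** The cross ratio of four hyperplanes through a common subspace is invariant
under linear isomorphisms, and the derivative of [phi] at [y] is a linear
isomorphism which carries each of the four hyperplanes that define [chi] at [y]
to the corresponding one at [phi y].

For the hyperplane spanned by the tangent space and a radial line, this is the
hypothesis on radial lines together with [tangent_space_diffeomorphism]: the
velocities of curves are transported by the chain rule. For the limiting tangent
hyperplanes of the sheets it is [is_limiting_tangent_diffeomorphism]: the
tangent spaces of the sheets are transported at each point, and [d phi_u v]
depends continuously on [u] and [v] jointly ([cvg_diff]), so the images of
convergent frames converge; the limit is then identified by its uniqueness.

The two sets of possible values of the cross ratio are equal
([is_hyperplane_cross_ratio_img], for the isomorphism and for its inverse): an
isomorphism carries a transverse plane, a basis of it and the four lines in it
to objects of the same kind without changing any coordinate. Hence the cross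
ratios agree, and a fortiori their orbits under [S_3].

Velocities come from smooth curves, so their transport also needs [phi \o c] to
be smooth for a smooth curve [c]. Smoothness being defined by iterated
directional derivatives, this is an induction on the order ([Ck_on_comp]). *)

(** * Functions of class C^k *)

Section calculus.
Set Implicit Arguments.
Unset Strict Implicit.
Context {R : realType}.

(** The first order expansion of [f] at [x] is also one of [g], and such an
expansion determines the differential. *)
Lemma near_eq_differentiable (V W : normedModType R) (f g : V -> W) (x : V) :
  (\near x, f x = g x) -> differentiable f x -> differentiable g x.
Proof.
move=> fg df.
have fgx : f x = g x by exact: nbhs_singleton fg.
have key : g \o shift x = cst (g x) + 'd f x +o_ 0 id.
  apply/eqaddoP => e e0.
  have /eqaddoP/(_ e e0) H := diff_locally df.
  have fg0 : \forall h \near (0 : V), f (h + x) = g (h + x).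
    by move: fg; rewrite (near_shift 0) /= subr0.
  apply: filterS2 fg0 H => h /= fgh.
  rewrite [X in `|X|]/(f (h + x) - (f x + 'd f x h)).
  by rewrite fgh fgx.
apply/diff_locallyP; rewrite (diff_unique (diff_continuous df) key).
by split => //; exact: diff_continuous.
Qed.

(** The product rule for [f z *: g z] is the chain rule for the pair [(f, g)]
followed by this bilinear map. *)
Lemma scale_is_bilinear (W : normedModType R) :
  bilinear_for
    (GRing.Scale.Law.clone _ _ *:%R _) (GRing.Scale.Law.clone _ _ *:%R _)
    (@GRing.scale R W : R^o -> W -> W).
Proof.
split=> [u'|u] a x y /=.
- by rewrite scalerDl scalerA.
- by rewrite scalerDr !scalerA mulrC.
Qed.
HB.instance Definition _ (W : normedModType R) :=
  bilinear_isBilinear.Build R R^o W W _ _ (@GRing.scale R W : R^o -> W -> W)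
  (scale_is_bilinear W).

Lemma differentiable_scale (V W : normedModType R) (f : V -> R^o) (g : V -> W) x :
  differentiable f x -> differentiable g x ->
  differentiable (fun z => f z *: g z) x /\
  forall v, 'D_v (fun z => f z *: g z) x = 'D_v f x *: g x + f x *: 'D_v g x.
Proof.
move=> df dg.
pose b : {bilinear R^o -> W -> W} := (@GRing.scale R W : R^o -> W -> W).
have bc : continuous (fun p : R^o * W => b p.1 p.2).
  exact: scale_continuous.
have db p := differentiable_bilin p bc.
have dp := differentiable_pair df dg.
have dc : differentiable (fun z => f z *: g z) x.
  exact: (differentiable_comp dp (db _)).
split => // v; rewrite !deriveE //.
rewrite -[fun z => _]/((fun p => b p.1 p.2) \o (fun z => (f z, g z))).
by rewrite (diff_comp dp (db _)) /= (diff_bilin _ bc) (diff_pair df dg) addrC.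
Qed.

(** Openness of [A] makes the two functions agree near each point of [A], which
is what their directional derivatives depend on. The lemmas below rely on it to
replace a derivative by the formula that holds for it on [A] only. *)
Lemma Ck_on_eq (V W : normedModType R) k (A : set V) (f g : V -> W) :
  open A -> (forall x, A x -> f x = g x) -> Ck_on k A f -> Ck_on k A g.
Proof.
move=> oA; elim: k f g => [|k IH] f g fg /=.
  move=> cf x Ax.
  have fgx : \near x, f x = g x.
    by apply: filterS fg _; exact: open_nbhs_nbhs.
  suff : g @ x --> g x by []; rewrite -(fg _ Ax); apply: cvg_trans (cf x Ax).
  exact: near_eq_cvg.
have near_fg x : A x -> \near x, f x = g x.
  by move=> Ax; apply: filterS fg _; exact: open_nbhs_nbhs.
move=> [df Df]; split.
  by move=> x Ax; exact: near_eq_differentiable (near_fg _ Ax) (df x Ax).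
move=> v; apply: IH (Df v) => x Ax; apply: near_eq_derive; exact: near_fg.
Qed.

Lemma Ck_on_sub (V W : normedModType R) k (A B : set V) (f : V -> W) :
  B `<=` A -> Ck_on k A f -> Ck_on k B f.
Proof.
move=> BA; elim: k f => [|k IH] f /=; first by move=> cf x /BA /cf.
by move=> [df Df]; split => [x /BA /df//|v]; apply: IH.
Qed.

Lemma Ck_onW (V W : normedModType R) k (A : set V) (f : V -> W) :
  Ck_on k.+1 A f -> Ck_on k A f.
Proof.
elim: k f => [|k IH] f [df Df].
  by move=> x /df; exact: differentiable_continuous.
by split => // v; apply: IH.
Qed.

Lemma Ck_on_cst (V W : normedModType R) k (A : set V) (a : W) :
  Ck_on k A (cst a).
Proof.
elim: k a => [|k IH] a /=; first by move=> x _; exact: cvg_cst.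
split=> [x _|v]; first exact: differentiable_cst.
rewrite [X in Ck_on _ _ X](_ : _ = cst 0) //.
by apply/funext => x; rewrite derive_cst.
Qed.

Lemma Ck_onD (V W : normedModType R) k (A : set V) (f g : V -> W) :
  open A -> Ck_on k A f -> Ck_on k A g -> Ck_on k A (f + g).
Proof.
move=> oA; elim: k f g => [|k IH] f g /=.
  by move=> cf cg x Ax; apply: cvgD; [exact: cf|exact: cg].
move=> [df Df] [dg Dg]; split=> [x Ax|v].
  by apply: differentiableD; [exact: df|exact: dg].
apply: (Ck_on_eq oA) (IH _ _ (Df v) (Dg v)) => x Ax.
by rewrite deriveD //; apply: diff_derivable; [exact: df|exact: dg].
Qed.

Lemma Ck_on_sum (V W : normedModType R) k (A : set V) m (f : 'I_m -> V -> W) :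
  open A -> (forall i, Ck_on k A (f i)) -> Ck_on k A (\sum_i f i).
Proof.
move=> oA Cf; elim/big_ind: _ => //; first exact: Ck_on_cst.
by move=> g h; exact: Ck_onD.
Qed.

Lemma Ck_on_scale (V W : normedModType R) k (A : set V)
    (f : V -> R^o) (g : V -> W) :
  open A -> Ck_on k A f -> Ck_on k A g -> Ck_on k A (fun z => f z *: g z).
Proof.
move=> oA; elim: k f g => [|k IH] f g.
  by move=> cf cg x Ax; apply: cvgZ; [exact: cf|exact: cg].
move=> Cf Cg; have [df Df] := Cf; have [dg Dg] := Cg; split=> [x Ax|v].
  by have [] := differentiable_scale (df x Ax) (dg x Ax).
apply: (Ck_on_eq oA) (Ck_onD oA (IH _ _ (Df v) (Ck_onW Cg))
                                (IH _ _ (Ck_onW Cf) (Dg v))) => x Ax.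
by have [_ ->] := differentiable_scale (df x Ax) (dg x Ax).
Qed.

Lemma Ck_on_coord (V : normedModType R) k (A : set V) m (f : V -> 'rV[R]_m) i :
  open A -> Ck_on k A f -> Ck_on k A (fun z => f z ord0 i : R^o).
Proof.
move=> oA; elim: k f => [|k IH] f.
  move=> cf x Ax; apply: (@continuous_comp _ _ _ f (fun M => M ord0 i)).
    exact: cf.
  exact: coord_continuous.
move=> [df Df]; split=> [x Ax|v].
  apply: (@differentiable_comp _ _ _ _ f (fun M => M ord0 i : R^o)).
    exact: df.
  exact: differentiable_coord.
apply: (Ck_on_eq oA) (IH _ (Df v)) => x Ax.
rewrite derive_mx ?mxE //; exact/diff_derivable/df.
Qed.

Lemma diff_row_sum (W : normedModType R) m (f : 'rV[R]_m -> W) x v :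
  differentiable f x ->
  'd f x v = \sum_i v ord0 i *: 'D_(delta_mx ord0 i) f x.
Proof.
move=> df; rewrite {1}[v]row_sum_delta linear_sum.
by apply: eq_bigr => i _; rewrite linearZ deriveE.
Qed.

(** By the chain rule, a directional derivative of [f \o g] is the sum of the
products of the coordinates of a derivative of [g] by partial derivatives of [f]
composed with [g]; to the latter the induction hypothesis applies. *)
Lemma Ck_on_comp (V W : normedModType R) k (A : set V) m (B : set 'rV[R]_m)
    (f : 'rV[R]_m -> W) (g : V -> 'rV[R]_m) :
  open A -> g @` A `<=` B -> Ck_on k A g -> Ck_on k B f -> Ck_on k A (f \o g).
Proof.
move=> oA gAB; have gB x : A x -> B (g x) by move=> Ax; apply: gAB; exists x.
elim: k f => [|k IH] f.
  move=> cg cf x Ax; apply: continuous_comp; first exact: cg.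
  exact/cf/gB.
move=> Cg Cf; have [dg Dg] := Cg; have [df Df] := Cf; split=> [x Ax|v].
  by apply: differentiable_comp; [exact: dg|exact/df/gB].
have S : Ck_on k A (\sum_(i < m)
    fun z => 'D_v g z ord0 i *: ('D_(delta_mx ord0 i) f \o g) z).
  apply: Ck_on_sum => // i; apply: Ck_on_scale => //.
    exact: (Ck_on_coord i oA (Dg v)).
  exact: (IH _ (Ck_onW Cg) (Df _)).
apply: (Ck_on_eq oA) S => x Ax; rewrite fct_sumE.
rewrite [RHS]deriveE; last by apply: differentiable_comp; [exact: dg|exact/df/gB].
rewrite diff_comp /=; [|exact: dg|exact/df/gB].
rewrite diff_row_sum; last exact/df/gB.
by apply: eq_bigr => i _; rewrite deriveE //; exact: dg.
Qed.

(** Joint continuity of the differential in the point and the vector, from the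
continuity of the partial derivatives. *)
Lemma cvg_diff (W : normedModType R) m (B : set 'rV[R]_m) (f : 'rV[R]_m -> W)
    (T : Type) (F : set_system T) {FF : Filter F} (u e : T -> 'rV[R]_m) y v :
  open B -> B y -> Ck_on 1 B f ->
  u @ F --> y -> e @ F --> v -> (fun t => 'd f (u t) (e t)) @ F --> 'd f y v.
Proof.
move=> oB By [df Df] uy ev.
have uB : \forall t \near F, B (u t) by apply: uy; exact: open_nbhs_nbhs.
have key : (fun t => \sum_i e t ord0 i *: 'D_(delta_mx ord0 i) f (u t)) @ F -->
    \sum_i v ord0 i *: 'D_(delta_mx ord0 i) f y.
  apply: cvg_big => [|i _]; first exact: add_continuous.
  apply: cvgZ.
    apply: (@continuous_cvg _ _ _ F FF e (fun M : 'rV[R]_m => M ord0 i)) ev.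
    exact: coord_continuous.
  apply: (@continuous_cvg _ _ _ F FF u (fun z => 'D_(delta_mx ord0 i) f z)) uy.
  exact: Df.
rewrite -(diff_row_sum v (df _ By)) in key.
apply: cvg_trans key; apply: near_eq_cvg; apply: filterS uB => t But.
exact/esym/diff_row_sum/df.
Qed.

End calculus.

(** * Transport of tangent spaces by a diffeomorphism *)

Section diffeomorphisms.
Set Implicit Arguments.
Unset Strict Implicit.
Context {R : realType} {n : nat}.
Local Notation E := 'rV[R]_n.
Implicit Types (W : set E) (phi psi : E -> E).

Lemma smooth_differentiable W phi x :
  smooth_on W phi -> W x -> differentiable phi x.
Proof. by move=> /(_ 1%N) [d _] /d. Qed.

Lemma diffeomorphism_inverse (W W' : set E) phi : diffeomorphism W W' phi ->
  exists psi, [/\ diffeomorphism W' W psi, forall x, W x -> psi (phi x) = x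
    & forall y, W' y -> phi (psi y) = y].
Proof.
move=> [oW oW' sphi phiW [psi [spsi psiK]]]; exists psi.
have phiK y : W' y -> phi (psi y) = y.
  by rewrite -phiW => -[x Wx <-]; rewrite psiK.
have Wphi x : W x -> W' (phi x) by move=> Wx; rewrite -phiW; exists x.
split => //; split => //; last by exists phi.
apply/seteqP; split=> [_ [y + <-]|x Wx].
  by rewrite -phiW => -[x Wx <-]; rewrite psiK.
by exists (phi x); [exact: Wphi|exact: psiK].
Qed.

Lemma diff_diffeomorphismK (W W' : set E) phi psi x v :
  diffeomorphism W W' phi -> smooth_on W' psi ->
  (forall x, W x -> psi (phi x) = x) -> W x ->
  'd psi (phi x) ('d phi x v) = v.
Proof.
move=> [oW _ sphi phiW _] spsi psiK Wx.
have dphi := smooth_differentiable sphi Wx.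
have W'x : W' (phi x) by rewrite -phiW; exists x.
have dpsi := smooth_differentiable spsi W'x.
rewrite -[LHS]/(('d psi (phi x) \o 'd phi x) v) -diff_comp //.
rewrite -deriveE; last exact: differentiable_comp.
rewrite -[RHS](derive_id x v); apply: near_eq_derive; apply: filterS psiK _.
exact: open_nbhs_nbhs.
Qed.

Definition lin_diff phi x : 'End(E) := linfun ('d phi x).

Lemma lin_diffE phi x v : lin_diff phi x v = 'd phi x v.
Proof. by rewrite lfunE. Qed.

Lemma lker_lin_diff (W W' : set E) phi x :
  diffeomorphism W W' phi -> W x -> lker (lin_diff phi x) == 0%VS.
Proof.
move=> dphi Wx; have [psi [[_ _ spsi _ _] psiK _]] := diffeomorphism_inverse dphi.
apply/lker0P; apply: (can_inj (g := 'd psi (phi x))) => v.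
by rewrite lin_diffE (diff_diffeomorphismK _ dphi).
Qed.

(** The image under [phi] of a curve in [M] through [y], restricted to the open
set of times at which it lies in [W], is a curve in [M']. *)
Lemma tangent_vector_diffeomorphism (W W' : set E) phi (M M' : set E) y v :
  diffeomorphism W W' phi -> phi @` (M `&` W) `<=` M' -> W y ->
  tangent_vector M y v -> tangent_vector M' (phi y) ('d phi y v).
Proof.
move=> [oW _ sphi _ _] MM' Wy [I [c [[oI I0] sc cM c0 c'v]]].
pose J := I `&` c @^-1` W.
have cc t : I t -> continuous_at t c by exact: (sc 0%N).
have oJ : open J.
  rewrite openE => t [It Wct]; apply: filterI; first exact: open_nbhs_nbhs.
  by apply: (cc t It); exact: open_nbhs_nbhs.
have J0 : J 0 by split => //; rewrite /= c0.
have dc : differentiable (c : R^o -> E) 0 by have [+ _] := sc 1%N; apply.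
have dphi := smooth_differentiable sphi Wy.
exists J, (phi \o c); split => //.
- move=> k; apply: (@Ck_on_comp _ R^o E k J n W phi c oJ) => //.
    by move=> _ [t [_ ? <-]].
  by apply: Ck_on_sub (sc k) => t [].
- move=> _ [t [It Wct] <-]; apply: MM'; exists (c t) => //.
  by split => //; apply: cM; exists t.
- by rewrite /= c0.
have dphi0 : differentiable phi (c 0) by rewrite c0.
rewrite -c'v (derive1E' dc) (derive1E' (differentiable_comp dc dphi0)).
apply: etrans (congr1 (fun g : R^o -> E => g 1) (diff_comp dc dphi0)) _.
by rewrite -c0.
Qed.

Lemma tangent_space_eq (M : set E) y (T : {vspace E}) :
  (forall v, v \in T <-> tangent_vector M y v) -> tangent_space M y = T.
Proof.
move=> HT; rewrite /tangent_space; case: xgetP => [T' _ /= HT'|/(_ T)/(_ HT)//].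
by apply/vspaceP => v; apply/idP/idP => [/HT'/HT|/HT/HT'].
Qed.

(** Tangent vectors correspond under the differentials of [phi] and of its
inverse. *)
Lemma tangent_space_diffeomorphism (W W' : set E) phi (M M' : set E) y :
  diffeomorphism W W' phi -> phi @` (M `&` W) = M' `&` W' -> W y ->
  tangent_space M' (phi y) = (lin_diff phi y @: tangent_space M y)%VS.
Proof.
move=> dphi MM' Wy.
have [psi [dpsi psiK phiK]] := diffeomorphism_inverse dphi.
have [_ _ sphi phiW _] := dphi; have [_ _ spsi psiW _] := dpsi.
have W'y : W' (phi y) by rewrite -phiW; exists y.
have M'M : psi @` (M' `&` W') `<=` M.
  by rewrite -MM' => _ [_ [x [Mx Wx] <-] <-]; rewrite psiK.
have tv v : tangent_vector M' (phi y) ('d phi y v) <-> tangent_vector M y v.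
  split; last first.
    apply: tangent_vector_diffeomorphism dphi _ Wy.
    by rewrite MM' => ? [].
  move=> /(tangent_vector_diffeomorphism dpsi M'M W'y).
  by rewrite psiK // (diff_diffeomorphismK _ dphi).
have dK w : 'd phi y ('d psi (phi y) w) = w.
  by have := diff_diffeomorphismK w dpsi sphi phiK W'y; rewrite psiK.
have kphi := lker_lin_diff dphi Wy.
have tvT (T : {vspace E}) :
    (forall v, v \in T <-> tangent_vector M y v) <->
    (forall w, w \in (lin_diff phi y @: T)%VS <-> tangent_vector M' (phi y) w).
  have memT v : ('d phi y v \in (lin_diff phi y @: T)%VS) = (v \in T).
    rewrite -lin_diffE; apply/idP/idP => [/memv_imgP[u uT]|]; last exact: memv_img.
    by move/(lker0P kphi) ->.
  split=> HT.
    by move=> w; rewrite -(dK w) memT tv; exact: HT.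
  by move=> v; rewrite -memT -tv; exact: HT.
case: (pselect (exists T : {vspace E},
    forall v, v \in T <-> tangent_vector M y v)).
  by move=> [T HT]; rewrite (tangent_space_eq HT); apply/tangent_space_eq/tvT.
(* Here no subspace consists of the tangent vectors to [M], hence none of those
   to [M'] either, and both tangent spaces have the default value 0. *)
move=> noT; rewrite {2}/tangent_space xgetPN => [|T HT]; last first.
  by apply: noT; exists T.
rewrite limg0 /tangent_space xgetPN // => T' HT'; apply: noT.
exists ((lin_diff phi y)^-1 @: T')%VS; apply/tvT.
by rewrite -limg_comp lker0_compfV // lim1g.
Qed.

End diffeomorphisms.

(** * Limiting tangent hyperplanes and cross ratios *)

Section limits.
Set Implicit Arguments.
Unset Strict Implicit.
Context {R : realType} {n : nat}.
Local Notation E := 'rV[R]_n.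

(** A sequence [u] in [S'] tending to [phi y] is pulled back to [S], convergent
frames of the tangent spaces of [S] are found there, and they are pushed forward
by the differentials of [phi] at the points [psi (u k)]. *)
Lemma is_limiting_tangent_diffeomorphism (W W' : set E) (phi : E -> E)
    (S S' : set E) y (H : {vspace E}) :
  diffeomorphism W W' phi -> phi @` (S `&` W) = S' `&` W' -> W y ->
  is_limiting_tangent S y H ->
  is_limiting_tangent S' (phi y) (lin_diff phi y @: H)%VS.
Proof.
move=> dphi SS' Wy limH u S'u u_y.
have [psi [dpsi psiK phiK]] := diffeomorphism_inverse dphi.
have [oW oW' sphi phiW _] := dphi; have [_ _ spsi psiW _] := dpsi.
have W'y : W' (phi y) by rewrite -phiW; exists y.
have [N _ NW'] : \forall k \near \oo, W' (u k).
  by apply: u_y; exact: open_nbhs_nbhs.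
have SWpsi k : (N <= k)%N -> S (psi (u k)) /\ W (psi (u k)).
  move=> Nk; have : (S' `&` W') (u k) by split; [exact: S'u|exact: NW'].
  by rewrite -SS' => -[x [Sx Wx] <-]; rewrite psiK.
have psiu_y : psi (u k) @[k --> \oo] --> y.
  rewrite -[X in _ --> X](psiK _ Wy).
  by apply: continuous_cvg u_y; exact: (spsi 0%N).
(* Only the terms of index at least [N] are known to lie in [W'], hence the
   shift. *)
have [e [f [Be ef Bf]]] := limH (fun k => psi (u (k + N)%N))
  (fun k => (SWpsi _ (leq_addl k N)).1)
  (cvg_comp (addn^~ N) (psi \o u) (cvg_addnr N) psiu_y).
exists (fun i k => 'd phi (psi (u k)) (e i (k - N)%N)),
  (fun i => 'd phi y (f i)).
split.
- have BeN : \forall k \near \oo,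
      basis_of (tangent_space S (psi (u (k - N + N)%N)))
        [seq e i (k - N)%N | i <- enum 'I_n.-1] by exact: (@cvg_subnr N _ Be).
  have leN : \forall k \near \oo, (N <= k)%N by exists N.
  apply: filterS2 BeN leN => k /= Bk Nk; rewrite subnK // in Bk.
  have [Sk Wk] := SWpsi k Nk.
  have kD := lker_lin_diff dphi Wk.
  have := tangent_space_diffeomorphism dphi SS' Wk.
  rewrite phiK; last exact: NW'.
  move=> ->.
  have := limg_basis_of (f := lin_diff phi (psi (u k))) _ Bk.
  rewrite (eqP kD) capv0 => /(_ erefl); rewrite -map_comp.
  by under eq_map => i do rewrite /= lin_diffE.
- move=> i; apply: (cvg_diff oW Wy (sphi 1%N) psiu_y).
  by rewrite -(cvg_shiftn N); under eq_fun do rewrite addnK; exact: ef.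
- have := limg_basis_of (f := lin_diff phi y) _ Bf.
  rewrite (eqP (lker_lin_diff dphi Wy)) capv0 => /(_ erefl); rewrite -map_comp.
  by under eq_map => i do rewrite /= lin_diffE.
Qed.

Lemma limiting_tangent_eq (S : set E) y H :
  (exists! H, is_limiting_tangent S y H) -> is_limiting_tangent S y H ->
  limiting_tangent S y = H.
Proof.
move=> [H0 [_ uniq]] limH; rewrite /limiting_tangent.
by case: xgetP => [T _ /= /uniq <-|/(_ H)/(_ limH)//]; exact: uniq.
Qed.

(** Apply [D] to the transverse plane and to its basis: the coordinates of the
four lines stay the same. *)
Lemma is_hyperplane_cross_ratio_img (D : 'End(E)) (L H1 H2 H3 H4 : {vspace E}) l :
  lker D == 0%VS -> is_hyperplane_cross_ratio L H1 H2 H3 H4 l ->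
  is_hyperplane_cross_ratio (D @: L) (D @: H1) (D @: H2) (D @: H3) (D @: H4) l.
Proof.
move=> kD [P [e [f [Bef LP0 LPT [u1 [u2 [u3 [u4 [HP1 HP2 HP3 HP4 ->]]]]]]]]].
have line (u : R * R) :
    (D @: <[u.1 *: e + u.2 *: f]> = <[u.1 *: D e + u.2 *: D f]>)%VS.
  by rewrite limg_line linearD !linearZ.
exists (D @: P)%VS, (D e), (D f); split.
- have := @limg_basis_of _ _ _ D P [:: e; f]; apply => //.
  by rewrite (eqP kD) capv0.
- by rewrite -lker0_img_cap // LP0 limg0.
- by rewrite -limgD LPT lker0_limgf.
by exists u1, u2, u3, u4; rewrite -!lker0_img_cap // HP1 HP2 HP3 HP4 !line.
Qed.

Lemma hyperplane_cross_ratio_img (D : 'End(E)) (L H1 H2 H3 H4 : {vspace E}) :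
  lker D == 0%VS ->
  hyperplane_cross_ratio (D @: L) (D @: H1) (D @: H2) (D @: H3) (D @: H4) =
  hyperplane_cross_ratio L H1 H2 H3 H4.
Proof.
move=> kD; rewrite /hyperplane_cross_ratio; congr xget.
apply/seteqP; split=> l /=; last exact: is_hyperplane_cross_ratio_img.
have kD' : lker D^-1%VF == 0%VS.
  by apply/lker0P/(can_inj (lker0_lfunVK kD)).
have DK (T : {vspace E}) : (D^-1 @: (D @: T))%VS = T.
  by rewrite -limg_comp lker0_compVf // lim1g.
by move/(is_hyperplane_cross_ratio_img kD'); rewrite !DK.
Qed.

End limits.

Theorem theorem5p2 (R : realType) (n : nat) (hn : (2 <= n)%N)
    (Omega1 Omega2 G1 G2 : set 'rV[R]_n)
    (S1 S2 : 'I_3 -> set 'rV[R]_n) (U U' : 'I_3 -> 'rV[R]_n -> 'rV[R]_n)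
    (W W' : set 'rV[R]_n) (phi : 'rV[R]_n -> 'rV[R]_n) (x : 'rV[R]_n) :
  region Omega1 -> region Omega2 ->
  A13_stratum Omega1 G1 -> A13_stratum Omega2 G2 ->
  (forall y, G1 y -> W y ->
     medial_sheets_at Omega1 G1 S1 y /\ radial_labelling Omega1 U y) ->
  (forall y, G2 y -> W' y ->
     medial_sheets_at Omega2 G2 S2 y /\ radial_labelling Omega2 U' y) ->
  G1 x -> W x ->
  diffeomorphism W W' phi ->
  phi @` (G1 `&` W) = G2 `&` W' ->
  (forall j, phi @` (S1 j `&` W) = S2 j `&` W') ->
  (forall j y, G1 y -> W y ->
     'd phi y @` [set` <[U j y]>%VS] = [set` <[U' j (phi y)]>%VS]) ->
  forall j y, G1 y -> W y ->
    chi G2 S2 (U' j) (phi y) = chi G1 S1 (U j) y.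
Proof.
move=> _ _ _ _ sheets1 sheets2 _ _ dphi GG' SS' UU' j y Gy Wy.
have [G'y W'y] : (G2 `&` W') (phi y) by rewrite -GG'; exists y.
have [[_ [_ lim1 _ _]] _] := sheets1 _ Gy Wy.
have [[_ [_ lim2 _ _]] _] := sheets2 _ G'y W'y.
pose D := lin_diff phi y.
have kD : lker D == 0%VS := lker_lin_diff dphi Wy.
have TD : tangent_space G2 (phi y) = (D @: tangent_space G1 y)%VS.
  exact: tangent_space_diffeomorphism dphi GG' Wy.
have SD i : limiting_tangent (S2 i) (phi y) = (D @: limiting_tangent (S1 i) y)%VS.
  apply: limiting_tangent_eq => //.
  apply: is_limiting_tangent_diffeomorphism dphi (SS' i) Wy _.
  by have [H [limH _]] := lim1 i; rewrite (limiting_tangent_eq (lim1 i) limH).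
have UD : (<[U' j (phi y)]> = D @: <[U j y]>)%VS.
  have eU w : (w \in <[U' j (phi y)]>%VS) <-> ('d phi y @` [set` <[U j y]>%VS]) w.
    by rewrite UU'.
  apply/vspaceP => w; apply/idP/idP => [/eU[v Uv <-]|/memv_imgP[v Uv ->]].
    by rewrite -lin_diffE; exact: memv_img.
  by apply/eU; exists v => //; rewrite lin_diffE.
rewrite /chi TD !SD UD -limgD; congr S3_orbit.
exact: hyperplane_cross_ratio_img.
Qed.
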